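(* $X^\pm$ is an absolutely irreducible $F\mathrm{Sp}_M$-module. Moreover, $$X^\pm\cong\mathrm{ind}_{\widehat{S}_{v_n}}^{\mathrm{Sp}_M}FE^\pm_{v_n},$$ where $\widehat{S}_{v_n}$ acts on the one-dimensional subspace $FE^\pm_{v_n}$ by means of $\chi^\pm_{v_n}$.
   Context: Let $F_q$ be a field with $q$ elements, of characteristic $p$ (any prime), $n\ge1$, $V$ a $2n$-dimensional $F_q$-space with a non-degenerate alternating form $\langle\ ,\ \rangle$; $\mathrm{Sp}$ is the group of all $g\in\mathrm{GL}(V)$ preserving the form, with center $Z(\mathrm{Sp})=\{1,-1\}$ (trivial if $p=2$). Fix a symplectic basis $u_1,\dots,u_n,v_1,\dots,v_n$: $\langle u_i,v_j\rangle=\delta_{ij}$, $\langle u_i,u_j\rangle=\langle v_i,v_j\rangle=0$. Put $M=\mathrm{span}\{u_i\}$, $N=\mathrm{span}\{v_i\}$. $\mathrm{Sp}^M$ is the pointwise stabilizer of $M$, $\mathrm{Sp}_{M,N}$ the subgroup preserving both $M$ and $N$, $\mathrm{Sp}_M=\mathrm{Sp}^M\rtimes\mathrm{Sp}_{M,N}$ the global stabilizer of $M$. $F$ is a field of characteristic $l\ne p$ containing a primitive $p$-th root of unity, and $\lambda:F_q^+\to F^*$ is a non-trivial linear character. For $v\in V$, $\chi_v(g)=\lambda(\langle gv,v\rangle)$. For $v\in N$, $S_v$ is the group of $g\in\mathrm{Sp}_M$ with $gv\equiv v\bmod M$ (on which $\chi_v$ is a linear character), and $\widehat{S}_v=S_v\times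 Z(\mathrm{Sp})$ is the group of $g\in\mathrm{Sp}_M$ with $gv\equiv\pm v\bmod M$. $\chi_v^\pm:\widehat S_v\to F^*$ is the homomorphism agreeing with $\chi_v$ on $S_v$ and mapping $-1\in Z(\mathrm{Sp})$ to $\pm1\in F^*$ (if $p=2$, $\widehat S_v=S_v$ and $\chi^\pm_v=\chi_v$). $X=X_\lambda$ is an $F$-space with basis $(E_v)_{v\in N}$, an $F\mathrm{Sp}_M$-module via $saE_v=\lambda(\langle sav,av\rangle)E_{av}$ ($s\in\mathrm{Sp}^M$, $a\in\mathrm{Sp}_{M,N}$). For $0\neq v\in N$: if $p$ is odd, $E_v^\pm=E_v\pm E_{-v}$; if $p=2$, $E_v^+=E_v^-=E_v$. $X^\pm$ is the span of all $E^\pm_v$, $0\ne v\in N$; it is an $F\mathrm{Sp}_M$-submodule of $X$. *)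

(* Defs.v *)
From HB Require Import structures.
From mathcomp Require Import all_boot all_order all_fingroup all_algebra.
From mathcomp Require Import all_solvable all_field all_character.

Set Implicit Arguments.
Unset Strict Implicit.
Unset Printing Implicit Defensive.

Import GroupScope GRing.Theory.
Local Open Scope ring_scope.

(* Composition convention.  A group of linear automorphisms of V is a group of
   permutations of V, and permutations are composed in the MathComp order:
   (g * h) v = h (g v).  The product written s a (first a, then s) in the
   left-action convention is therefore (a * s)%g here, and a left module for
   the left-action group is the same thing as a right module (row vectors
   acted on by matrices from the right) for the permutation group, which is
   what mx_representation describes. *)

Section Induction.

Variables (F : fieldType) (gT : finGroupType) (G H : {group gT}) (m : nat).
Hypothesis sHG : H \subset G.
Variable rH : mx_representation F H m.

Let coset_rep (i : 'I_#|G : H|) : gT := repr (enum_val i).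

(* W (x)_{FH} FG is the direct sum of the W (x) t, for t in a transversal of
   the right cosets of H in G, and (w (x) t) g = (w h) (x) t' whenever
   t g = h t' with h in H. *)
Definition ind_mx (g : gT) : 'M[F]_(\sum_(i < #|G : H|) m) :=
  \mxblock_(i < #|G : H|, j < #|G : H|)
     let h := (coset_rep i * g * (coset_rep j)^-1)%g in
     if h \in H then rH h else 0.

Let coset_rep_in i : coset_rep i \in G.
Proof.
have /rcosetsP[x Gx def_i] := enum_valP i.
rewrite /coset_rep def_i; case: repr_rcosetP => h Hh.
by rewrite groupM // (subsetP sHG).
Qed.

Let coset_repE i : enum_val i = (H :* coset_rep i)%g.
Proof.
have /rcosetsP[x Gx def_i] := enum_valP i.
by rewrite /coset_rep def_i rcoset_repr.
Qed.

Let coset_rep_exists x : x \in G -> {k | (H :* x)%g = (H :* coset_rep k)%g}.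
Proof.
move=> Gx; have Hx: (H :* x)%g \in rcosets H G by apply/rcosetsP; exists x.
by exists (enum_rank_in Hx (H :* x)%g); rewrite -coset_repE enum_rankK_in.
Qed.

Let coset_rep_uniq i j : (H :* coset_rep i)%g = (H :* coset_rep j)%g -> i = j.
Proof. by rewrite -!coset_repE => /enum_val_inj. Qed.

Lemma ind_mx_repr : mx_repr G ind_mx.
Proof.
split=> [|x y Gx Gy].
  rewrite -mxdiagZ /mxdiag; apply/eq_mxblockP => i j.
  rewrite /= mulg1; case: eqVneq => [-> | neq_ij].
    by rewrite mulgV group1 repr_mx1 conform_mx_id.
  case: ifP => // Hij; case/eqP: neq_ij; apply: coset_rep_uniq.
  by apply/rcoset_eqP; rewrite mem_rcoset.
rewrite mul_mxblock; apply/eq_mxblockP => i j.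
have [k def_k] := coset_rep_exists (groupM (coset_rep_in i) Gx).
have Hk : (coset_rep i * x * (coset_rep k)^-1)%g \in H.
  by rewrite -mem_rcoset; apply/rcoset_eqP.
rewrite /= (bigD1 k) //= big1 ?addr0 => [|k' neq_k'k]; last first.
  case: ifP => [Hk' | _]; last by rewrite mul0mx.
  case/eqP: neq_k'k; apply: coset_rep_uniq; rewrite -def_k.
  by apply/esym/rcoset_eqP; rewrite mem_rcoset.
rewrite Hk.
have -> : (coset_rep i * (x * y) * (coset_rep j)^-1 =
           coset_rep i * x * (coset_rep k)^-1 *
           (coset_rep k * y * (coset_rep j)^-1))%g.
  by rewrite !mulgA mulgKV.
rewrite groupMl //; case: ifP => [Hj | _]; last by rewrite mulmx0.
by rewrite repr_mxM.
Qed.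

Definition ind_repr := MxRepresentation ind_mx_repr.

End Induction.

Section SymplecticGroup.

Variables (Fq : finFieldType) (V : vectType Fq) (form : {skew_symmetric V}).
Local Notation fV := (finvect_type V).
Local Notation "''[' x , y ]" := (form x y) : ring_scope.

Definition Sp : {set {perm fV}} :=
  [set g : {perm fV} | [forall a : Fq, forall x : fV, forall y : fV,
              g (a *: x + y) == a *: g x + g y]
        && [forall x : fV, forall y : fV, '[g x, g y] == '[x, y]]].

Lemma SpP (g : {perm fV}) :
  reflect ((forall a x y, g (a *: x + y) = a *: g x + g y)
           /\ (forall x y, '[g x, g y] = '[x, y]))
          (g \in Sp).
Proof.
rewrite inE; apply: (iffP andP) => [[/forallP gL /forallP gI] | [gL gI]].
  split=> [a x y | x y]; last exact/eqP/(forallP (gI x)).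
  exact/eqP/(forallP (forallP (gL a) x)).
split; last by apply/forallP=> x; apply/forallP=> y; rewrite gI.
by apply/forallP=> a; apply/forallP=> x; apply/forallP=> y; rewrite gL.
Qed.

Lemma Sp_group_set : group_set Sp.
Proof.
apply/group_setP; split=> [|g h /SpP[gL gI] /SpP[hL hI]].
  by apply/SpP; split=> *; rewrite !perm1.
by apply/SpP; split=> *; rewrite !permM ?gL ?hL ?hI ?gI.
Qed.

Canonical Sp_group := Group Sp_group_set.

Definition symplectic_basis n (u v : 'I_n -> V) : Prop :=
  [/\ basis_of {:V} (codom u ++ codom v),
      forall i j, '[u i, v j] = (i == j)%:R,
      forall i j, '[u i, u j] = 0
    & forall i j, '[v i, v j] = 0].

Definition vset (U : {vspace V}) : {set fV} := [set x : fV | x \in U].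

Variables (n : nat) (u v : 'I_n -> V).
Definition Mspace : {vspace V} := <<codom u>>%VS.
Definition Nspace : {vspace V} := <<codom v>>%VS.
Local Notation M := Mspace.
Local Notation N := Nspace.

(* Sp_M (global stabilizer), Sp^M (pointwise stabilizer) and Sp_{M,N}. *)
Definition SpM_glob : {group {perm fV}} := 'N_Sp(vset M | 'P)%G.
Definition SpM_pt : {group {perm fV}} := 'C_Sp(vset M | 'P)%G.
Definition SpMN : {group {perm fV}} :=
  ('N_Sp(vset M | 'P) :&: 'N_Sp(vset N | 'P))%G.

Lemma SpM_globP (g : {perm fV}) :
  reflect (g \in Sp /\ forall x, (g x \in M) = (x \in M)) (g \in SpM_glob).
Proof.
rewrite in_setI; apply: (iffP andP) => [[Sg /astabsP gM] | [Sg gM]]; split=> //.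
  by move=> x; have:= gM x; rewrite !inE.
by apply/astabsP=> x; rewrite !inE; apply: gM.
Qed.

(* S_w and \hat S_w; for 0 != w in N the latter is S_w x Z(Sp). *)
Definition Sstab (w : V) : {set {perm fV}} :=
  [set g : {perm fV} in SpM_glob | g w - w \in M].
Definition hSstab (w : V) : {set {perm fV}} :=
  [set g : {perm fV} in SpM_glob | (g w - w \in M) || (g w + w \in M)].


Section BasisFacts.

Hypotheses (hform : is_psymplectic form) (hbasis : symplectic_basis u v).

Lemma form_skew x y : '[x, y] = - '[y, x].
Proof. by rewrite [LHS]hermitian_subproof expr1 mulN1r. Qed.

Lemma form_alt x : '[x, x] = 0.
Proof.
case: hform => _ _ alt2; have [/alt2-> // | odd_ch] := boolP (2%N \in [pchar Fq]).
have /eqP := form_skew x x.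
rewrite -addr_eq0 -mulr2n -mulr_natl mulf_eq0 => /orP[two0 | /eqP//].
by rewrite inE /= two0 in odd_ch.
Qed.

Lemma formDl x y z : '[x + y, z] = '[x, z] + '[y, z].
Proof. exact: linearDl. Qed.

Lemma formDr x y z : '[z, x + y] = '[z, x] + '[z, y].
Proof. exact: linearDr. Qed.

Lemma formNl x z : '[- x, z] = - '[x, z].
Proof. exact: linearNl. Qed.

Lemma formNr x z : '[z, - x] = - '[z, x].
Proof. exact: linearNr. Qed.

Lemma formZl a x z : '[a *: x, z] = a * '[x, z].
Proof. exact: linearZl_LR. Qed.

Lemma formZr a x z : '[z, a *: x] = a * '[z, x].
Proof. exact: linearZr_LR. Qed.

Lemma Sp_lin g : g \in Sp -> forall a x y, g (a *: x + y) = a *: g x + g y.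
Proof. by case/SpP. Qed.

Lemma Sp_add g : g \in Sp -> {morph g : x y / x + y}.
Proof. by move=> Sg x y; rewrite -[x in LHS]scale1r Sp_lin // scale1r. Qed.

Lemma Sp_0 g : g \in Sp -> g 0 = 0.
Proof. by move=> Sg; apply: (addrI (g 0)); rewrite -Sp_add // !addr0. Qed.

Lemma Sp_opp g : g \in Sp -> {morph g : x / - x}.
Proof.
by move=> Sg x; apply: (addrI (g x)); rewrite -Sp_add // !subrr Sp_0.
Qed.

Lemma Sp_iso g : g \in Sp -> forall x y, '[g x, g y] = '[x, y].
Proof. by case/SpP. Qed.

Lemma SpM_Sp g : g \in SpM_glob -> g \in Sp.
Proof. by case/SpM_globP. Qed.

Lemma SpM_mem g : g \in SpM_glob -> forall x, (g x \in M) = (x \in M).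
Proof. by case/SpM_globP. Qed.

Lemma hSstabE w g : (g \in hSstab w) =
  (g \in SpM_glob) && ((g w - w \in M) || (g w + w \in M)).
Proof. by rewrite in_set. Qed.

Lemma hSstab_group_set w : group_set (hSstab w).
Proof.
have grpM := group1 SpM_glob.
apply/group_setP; split=> [|g h].
  by rewrite hSstabE grpM /= perm1 subrr; apply/orP; left; apply: mem0v.
rewrite !hSstabE => /andP[Gg gw] /andP[Gh hw]; rewrite groupM //= permM.
have Sh := SpM_Sp Gh.
have auxN : g w - w \in M -> h (g w) - h w \in M.
  by move=> gwM; rewrite -Sp_opp // -Sp_add // SpM_mem.
have auxP : g w + w \in M -> h (g w) + h w \in M.
  by move=> gwM; rewrite -Sp_add // SpM_mem.
case/orP: gw => [/auxN | /auxP] gw; case/orP: hw => hw; apply/orP.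
- by left; rewrite -(subrK (h w) (h (g w))) -addrA; apply: memvD.
- by right; rewrite -(subrK (h w) (h (g w))) -addrA; apply: memvD.
- right; have -> : h (g w) + w = h (g w) + h w - (h w - w).
    by rewrite opprB addrCA addrK addrC.
  exact: memvB.
left; have -> : h (g w) - w = h (g w) + h w - (h w + w).
  by rewrite opprD addrA addrK.
exact: memvB.
Qed.

Canonical hSstab_group w := Group (hSstab_group_set w).

Lemma hSstab_sub w : hSstab w \subset SpM_glob.
Proof. by apply/subsetP=> g; rewrite hSstabE => /andP[]. Qed.

Lemma capNM : (N :&: M = 0)%VS.
Proof.
case: hbasis => /andP[_]; rewrite cat_free => /and3P[_ _ /directv_addP dMN] _ _ _.
by rewrite capvC.
Qed.

Lemma memNM0 x : x \in N -> x \in M -> x = 0.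
Proof.
by move=> Nx Mx; apply/eqP; rewrite -memv0 -capNM memv_cap Nx Mx.
Qed.

Lemma addNM : (N + M = fullv)%VS.
Proof. by case: hbasis => /andP[/eqP <- _] _ _ _; rewrite addvC span_cat. Qed.

Lemma M_isotropic x y : x \in M -> y \in M -> '[x, y] = 0.
Proof.
case: hbasis => _ _ uu _; have /orthovP : (M <= orthov form M)%VS; last exact.
apply/span_subvP=> _ /codomP[i ->]; rewrite mem_orthov_sym.
by apply/span_subvP=> _ /codomP[j ->]; rewrite mem_orthov1 uu.
Qed.

Lemma N_isotropic x y : x \in N -> y \in N -> '[x, y] = 0.
Proof.
case: hbasis => _ _ _ vv; have /orthovP : (N <= orthov form N)%VS; last exact.
apply/span_subvP=> _ /codomP[i ->]; rewrite mem_orthov_sym.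
by apply/span_subvP=> _ /codomP[j ->]; rewrite mem_orthov1 vv.
Qed.

End BasisFacts.

Definition projN (x : V) : V := daddv_pi N M x.

Section ProjFacts.

Hypotheses (hform : is_psymplectic form) (hbasis : symplectic_basis u v).

Lemma projN_in x : projN x \in N.
Proof. exact: memv_pi. Qed.

Lemma projN_sub x : x - projN x \in M.
Proof.
have xV : x \in (N + M)%VS by rewrite addNM ?memvf.
rewrite -[X in X - _](daddv_pi_add (capNM hbasis) xV) addrAC subrr add0r.
exact: memv_pi.
Qed.

Lemma projN_uniq x y : y \in N -> x - y \in M -> projN x = y.
Proof.
move=> Ny xyM; apply/eqP; rewrite -subr_eq0 -memv0 -(capNM hbasis) memv_cap.
rewrite memvB ?projN_in //= -opprB memvN.
have -> : y - projN x = (x - projN x) - (x - y).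
  by rewrite opprB addrCA addrAC subrr add0r.
by rewrite memvB ?projN_sub.
Qed.

End ProjFacts.

Section Weil.

Variables (F : fieldType) (lam : Fq -> F).

(* lam is a homomorphism from the additive group of Fq to the multiplicative
   group of F. *)
Definition additive_character : Prop :=
  lam 0 = 1 /\ {morph lam : a b / a + b >-> a * b}.

(* The rows of the matrices below are indexed by the vectors of N, and E w is
   the basis vector attached to w. *)
Definition Evec (w : fV) : 'rV[F]_#|vset N| := \row_j (enum_val j == w)%:R.

(* If g = (a * s)%g with a in Sp_{M,N} and s in Sp^M, and if w is in N, then
   a w is the component of g w in N. *)
Definition X_mx (g : {perm fV}) : 'M[F]_#|vset N| :=
  \matrix_(i < #|vset N|)
    (lam '[g (enum_val i), projN (g (enum_val i))]
       *: Evec (projN (g (enum_val i)))).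

Lemma Evec_mul g (w : fV) : w \in N ->
  Evec w *m X_mx g = lam '[g w, projN (g w)] *: Evec (projN (g w)).
Proof.
move=> Nw; have vNw : w \in vset N by rewrite in_set.
have -> : Evec w = delta_mx 0 (enum_rank_in vNw w).
  apply/rowP=> j; rewrite !mxE eqxx /=; congr (_%:R).
  by rewrite -(inj_eq enum_val_inj) enum_rankK_in.
by rewrite -rowE rowK enum_rankK_in.
Qed.

Section WeilModule.

Hypotheses (hform : is_psymplectic form) (hbasis : symplectic_basis u v).
Hypothesis hlam : additive_character.

Lemma v_in_N i : v i \in N.
Proof. exact/memv_span/codom_f. Qed.

Lemma M_orth x : (forall y, y \in M -> '[x, y] = 0) -> x \in M.
Proof.
move=> xM; suff px0 : projN x = 0.
  by have := projN_sub hbasis x; rewrite px0 subr0.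
have def_x : x = projN x + (x - projN x) by rewrite addrC subrK.
have /eqP nondeg : nondegenerate form by case: hform.
apply/eqP; rewrite -memv0 -nondeg; apply/mem_orthovP => y _.
have yV : y \in (N + M)%VS by rewrite addNM ?memvf.
have [y1 Ny1 [y2 My2 ->]] := memv_addP yV.
rewrite formDr (N_isotropic hbasis (projN_in _) Ny1) add0r.
have := xM _ My2; rewrite {1}def_x formDl.
by rewrite (M_isotropic hbasis (projN_sub hbasis x) My2) addr0.
Qed.

(* The defining formula s a E_w = lam(<s a w, a w>) E_(a w). *)
Lemma Evec_mul_as a s (w : fV) : a \in SpMN -> s \in SpM_pt -> w \in N ->
  Evec w *m X_mx (a * s)%g = lam '[(a * s)%g w, a w] *: Evec (a w).
Proof.
rewrite in_setI => /andP[_ /setIP[_ /astabsP aN]] /setIP[Ss /astabP sM] Nw.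
rewrite Evec_mul //; suff -> : projN ((a * s)%g w) = a w by [].
have Naw : a w \in N by have:= aN w; rewrite !in_set Nw.
apply: (projN_uniq hbasis) => //; rewrite permM; apply: M_orth => y My.
have sy : s y = y by apply: sM; rewrite in_set.
by rewrite formDl formNl -[in X in X - _]sy Sp_iso // subrr.
Qed.

Lemma SpM_projN g (w : fV) : g \in SpM_glob -> w \in N -> w != 0 -> projN (g w) != 0.
Proof.
move=> Gg Nw; apply: contraNneq => pgw0; apply/eqP.
have := projN_sub hbasis (g w); rewrite pgw0 subr0 (SpM_mem Gg) => Mw.
exact: memNM0.
Qed.

Lemma projN_opp x : projN (- x) = - projN x.
Proof. by rewrite /projN raddfN. Qed.

Lemma projN_add x y : projN (x + y) = projN x + projN y.
Proof. by rewrite /projN raddfD. Qed.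

Lemma X_mx_repr : mx_repr SpM_glob X_mx.
Proof.
case: hlam => lam0 lamD.
have ofEvec (A B : 'M[F]_#|vset N|) :
  (forall w : fV, w \in N -> Evec w *m A = Evec w *m B) -> A = B.
  move=> eqAB; apply/row_matrixP=> i; rewrite !rowE.
  have := enum_valP i; rewrite inE => Ni.
  have -> : delta_mx 0 i = Evec (enum_val i); last exact: eqAB.
  by apply/rowP=> j; rewrite !mxE eqxx /= (inj_eq enum_val_inj).
split=> [|g h Gg Gh]; apply: ofEvec => w Nw.
  have pw: projN w = w by apply: (projN_uniq hbasis); rewrite ?subrr ?mem0v.
  by rewrite Evec_mul // perm1 pw form_alt // lam0 scale1r mulmx1.
have [Sg Sh] := (SpM_Sp Gg, SpM_Sp Gh).
rewrite mulmxA !Evec_mul // permM -scalemxAl Evec_mul ?projN_in // scalerA.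
set w' := projN (g w).
have [m Mm def_gw] : exists2 m, m \in M & g w = w' + m.
  by exists (g w - w'); rewrite ?projN_sub // addrC subrK.
have Mhm : h m \in M by rewrite SpM_mem.
have def_hgw : h (g w) = h w' + h m by rewrite def_gw Sp_add.
have def_p : projN (h (g w)) = projN (h w').
  apply: (projN_uniq hbasis); first exact: projN_in.
  by rewrite def_hgw addrAC memvD ?projN_sub.
rewrite def_p -lamD; congr (lam _ *: _).
rewrite def_hgw formDl addrC; congr (_ + _).
transitivity '[h m, h w'].
  rewrite -[in RHS](subrK (projN (h w')) (h w')) formDr.
  by rewrite (M_isotropic hbasis Mhm (projN_sub hbasis _)) add0r.
by rewrite Sp_iso // def_gw formDl form_alt // add0r.
Qed.

Definition X_repr : mx_representation F SpM_glob #|vset N| :=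
  MxRepresentation X_mx_repr.

(* The sign +/- is the sign (-1) ^+ eps, and p is the characteristic of Fq. *)
Definition Epm (p : nat) (eps : bool) (w : fV) : 'rV[F]_#|vset N| :=
  if odd p then Evec w + (-1) ^+ eps *: Evec (- w) else Evec w.

Definition Xpm (p : nat) (eps : bool) : 'M[F]_#|vset N| :=
  (\sum_(w in vset N :\ (0 : fV)) <<Epm p eps w>>)%MS.

Lemma Epm_mul p eps g (w : fV) : g \in SpM_glob -> w \in N ->
  Epm p eps w *m X_mx g =
    lam '[g w, projN (g w)] *: Epm p eps (projN (g w)).
Proof.
move=> Gg Nw; rewrite /Epm; case: ifP => _; last exact: Evec_mul.
have NNw : - w \in N by apply: etrans Nw; apply: memvN.
rewrite mulmxDl -scalemxAl !Evec_mul // scalerDr !scalerA.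
rewrite (Sp_opp (SpM_Sp Gg)) projN_opp formNl formNr opprK.
by rewrite [in LHS]mulrC.
Qed.

Lemma Xpm_mod p eps : mxmodule X_repr (Xpm p eps).
Proof.
apply/mxmoduleP=> g Gg; rewrite /Xpm sumsmxMr; apply/sumsmx_subP=> w.
rewrite !inE => /andP[nzw Nw]; rewrite (eqmxMr _ (genmxE _)) /= Epm_mul //.
apply: scalemx_sub; apply: (sumsmx_sup (projN (g w) : fV)); last by rewrite genmxE.
by rewrite !inE SpM_projN ?projN_in.
Qed.

Definition Xpm_repr p eps := submod_repr (Xpm_mod p eps).

(* On \hat S_w: if g is not in S_w then - g is, and g = (- 1)(- g) is mapped to
   (-1) ^+ eps times the value of the linear character of S_w at - g. *)
Definition chi_pm (eps : bool) (w : fV) (g : {perm fV}) : F :=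
  if g \in Sstab w then lam '[g w, w] else (-1) ^+ eps * lam '[- g w, w].

Lemma chi_pm_mul (a b : Fq) g h (w : fV) :
    g \in SpM_glob -> h \in SpM_glob -> w \in N -> a * a = 1 -> b * b = 1 ->
    g w - a *: w \in M -> h w - b *: w \in M ->
  a * b * '[(g * h)%g w, w] = a * '[g w, w] + b * '[h w, w].
Proof.
move=> Gg Gh Nw aa bb Mg Mm'.
have [m Mm def_gw] : exists2 m, m \in M & g w = a *: w + m.
  by exists (g w - a *: w); rewrite // addrC subrK.
have [Sg Sh] := (SpM_Sp Gg, SpM_Sp Gh).
have Mhm : h m \in M by rewrite SpM_mem.
have def_bw : w = b *: h w - b *: (h w - b *: w).
  by rewrite scalerBr opprB addrCA subrr addr0 scalerA bb scale1r.
have hmw : '[h m, w] = b * '[g w, w].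
  rewrite [in LHS]def_bw formDr formNr !formZr (M_isotropic hbasis Mhm Mm').
  by rewrite mulr0 subr0 Sp_iso // def_gw formDl formZl form_alt // mulr0 add0r.
rewrite permM {1}def_gw Sp_lin // formDl formZl hmw mulrDr addrC.
by congr (_ + _); rewrite mulrA; [rewrite -(mulrA a) bb mulr1 | rewrite (mulrAC a b) aa mul1r].
Qed.

Lemma SstabE (g : {perm fV}) (w : fV) : g \in SpM_glob ->
  (g \in Sstab w) = (g w - w \in M).
Proof. by move=> Gg; rewrite in_set Gg. Qed.

Lemma chi_pm_opp eps (g : {perm fV}) (w : fV) :
  g \in SpM_glob -> w \in N -> w != - w ->
  g w + w \in M -> chi_pm eps w g = (-1) ^+ eps * lam '[- g w, w].
Proof.
move=> Gg Nw ww gw; rewrite /chi_pm SstabE //; case: ifP => // gw'; case/eqP: ww.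
apply/eqP; rewrite -addr_eq0; apply/eqP; apply: (memNM0 hbasis).
  exact: memvD.
by have := memvB gw gw'; rewrite opprB [g w + w]addrC addrACA subrr addr0.
Qed.

Lemma chi_pm_val eps (b : bool) (g : {perm fV}) (w : fV) :
    g \in SpM_glob -> w \in N -> (w == - w -> ~~ b) -> g w - (-1) ^+ b *: w \in M ->
  chi_pm eps w g = (-1) ^+ (eps && b) * lam ((-1) ^+ b * '[g w, w]).
Proof.
case: b => Gg Nw ww; last by rewrite scale1r /chi_pm SstabE // andbF !mul1r => ->.
rewrite scaleN1r opprK => gw; rewrite chi_pm_opp // ?andbT.
  by rewrite formNl mulN1r.
by apply/negP=> /ww.
Qed.

Lemma hSstab_sign (g : {perm fV}) (w : fV) : g \in hSstab w ->
  exists2 b : bool, (w == - w -> ~~ b) & g w - (-1) ^+ b *: w \in M.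
Proof.
rewrite hSstabE => /andP[_ gw].
case: (boolP (g w - w \in M)) gw => /= [gw _ | ngw gw].
  by exists false => //; rewrite scale1r.
exists true; last by rewrite scaleN1r opprK.
by move/eqP=> ww; rewrite [X in _ - X]ww opprK gw in ngw.
Qed.

Lemma chi_pm_repr eps (w : fV) : w \in N ->
  mx_repr (hSstab w) (fun g : {perm fV} => (chi_pm eps w g)%:M : 'M[F]_1).
Proof.
case: hlam => lam0 lamD Nw.
split=> [|g h Gg Gh].
  by rewrite /chi_pm SstabE ?group1 // perm1 subrr form_alt // lam0 [_ \in _]mem0v.
have [[b wb gw] [c wc hw]] := (hSstab_sign Gg, hSstab_sign Gh).
have [Mg Mh] := (subsetP (hSstab_sub w) _ Gg, subsetP (hSstab_sub w) _ Gh).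
have Sh := SpM_Sp Mh.
have sgn2 (d : bool) : (-1) ^+ d * (-1) ^+ d = 1 :> Fq by rewrite -expr2 sqrr_sign.
rewrite -scalar_mxM; congr _%:M.
rewrite (chi_pm_val _ Mg Nw wb gw) (chi_pm_val _ Mh Nw wc hw).
rewrite (@chi_pm_val eps (b (+) c)) ?groupM //.
- rewrite andb_addr !signr_addb (chi_pm_mul Mg Mh Nw (sgn2 b) (sgn2 c) gw hw).
  by rewrite lamD mulrACA.
- by move=> ww; rewrite (negbTE (wb ww)) (negbTE (wc ww)).
rewrite permM; have [m Mm ->] : exists2 m, m \in M & g w = (-1) ^+ b *: w + m.
  by exists (g w - (-1) ^+ b *: w); rewrite // addrC subrK.
have Mhm : h m \in M by rewrite SpM_mem.
rewrite Sp_lin // signr_addb -scalerA addrAC -scalerBr.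
by apply: memvD => //; apply: memvZ.
Qed.

Definition chi_repr eps (w : fV) (Nw : w \in N) :
    mx_representation F (hSstab_group w) 1 :=
  MxRepresentation (chi_pm_repr eps Nw).

End WeilModule.

End Weil.

End SymplecticGroup.

(* Main.v *)
Require Import Defs.
From HB Require Import structures.
From mathcomp Require Import all_boot all_order all_fingroup all_algebra.
From mathcomp Require Import all_solvable all_field all_character.
From mathcomp Require Import ring.

Set Implicit Arguments.
Unset Strict Implicit.
Unset Printing Implicit Defensive.

Import GroupScope GRing.Theory.
Local Open Scope ring_scope.

(** Why the theorem holds. Write [H] for the stabilizer [hSstab] of a non-zero
    [w] in [N], and [t_i] for representatives of its right cosets in the
    stabilizer [G] of [M].

    The subgroup [H] acts on the line of [E_w^+-] by [chi_w^+-]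
    ([hSstab_Epm]), so Frobenius reciprocity ([ind_homP]) gives a homomorphism
    from the induced module to [X] that sends the standard basis to the
    translates [E_w^+- t_i]. Each translate is a non-zero multiple of
    [E_(w_i)^+-], where [w_i] is the component of [t_i w] in [N]. The [w_i] are
    distinct up to sign, since [H] is exactly the stabilizer of [+-w] modulo
    [M]; hence the translates are linearly independent
    ([Epm_translates_free]). They span [X^+-] because [G] is transitive on the
    non-zero vectors of [V / M] ([SpM_transitive], [Epm_translates_eq]). This
    is the isomorphism with the induced module.

    In the basis of translates the representation is monomial, and two kinds
    of elements decide absolute irreducibility. The transvections along
    vectors of [M] act diagonally, and no two coordinates carry the same
    character: on [E_w] such a transvection acts by [lam (- c <w,m>^2)], and
    when [w' <> +-w] some [m] in [M] pairs non-trivially with both [w - w'] and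
    [w + w'] ([SpM_pt_separates]); this works in every characteristic. The
    elements [t_i^-1 t_j] move the [i]-th basis vector to the [j]-th. Together
    they produce all the matrix units in the enveloping algebra
    ([separated_monomial_abs_irr]), and that property is stable under extension
    of scalars. *)

(** * A criterion for absolute irreducibility *)

Section MonomialCriterion.

Variables (F : fieldType) (gT : finGroupType) (G : {group gT}) (n : nat).
Variable rG : mx_representation F G n.
Local Notation E_G := (enveloping_algebra_mx rG).

(** For each pair of coordinates some element of [G] acts diagonally with
    different entries there, so Lagrange-style products of the matrices
    [rG t - a] isolate one coordinate and put every [delta_mx i i] in the
    enveloping algebra. The elements permuting the coordinate lines turn these
    into all the matrix units: the enveloping algebra is the whole matrix
    algebra, over any field. *)
Lemma separated_monomial_abs_irr :
    (0 < n)%N ->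
    (forall i j : 'I_n, i != j ->
       exists t d, [/\ t \in G, rG t = diag_mx d & d 0 i != d 0 j]) ->
    (forall i j : 'I_n, exists2 g, g \in G &
       exists2 c : F, c != 0 & row i (rG g) = c *: delta_mx 0 j) ->
  mx_absolutely_irreducible rG.
Proof.
move=> n_gt0 sep trans; rewrite /mx_absolutely_irreducible n_gt0 /=.
(* [d] is the product over [j] in [s] of the factors [e - e 0 j], where
   [diag_mx e] separates [i] from [j] *)
have diagE (i : 'I_n) (s : seq 'I_n) : i \notin s -> exists2 d : 'rV_n,
    (diag_mx d \in E_G)%MS & d 0 i != 0 /\ {in s, forall j, d 0 j = 0}.
  elim: s => [|j s IHs]; first move=> _.
    exists (const_mx 1); first by rewrite diag_const_mx envelop_mx1.
    by split=> //; rewrite mxE oner_neq0.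
  rewrite inE negb_or => /andP[neq_ij /IHs[d Ed [di ds]]].
  have [t [e [Gt def_t eij]]] := sep _ _ neq_ij.
  exists (\row_k (d 0 k * (e 0 k - e 0 j))); last first.
    split=> [|k]; first by rewrite mxE mulf_neq0 // subr_eq0.
    rewrite inE mxE => /orP[/eqP-> | /ds->]; first by rewrite subrr mulr0.
    by rewrite mul0r.
  have -> : diag_mx (\row_k (d 0 k * (e 0 k - e 0 j)))
      = diag_mx d *m (rG t - e 0 j *: 1%:M).
    rewrite def_t scalemx1 -diag_const_mx -linearB /= mulmx_diag.
    by congr diag_mx; apply/rowP=> k; rewrite !mxE.
  apply: envelop_mxM => //; rewrite linearB /= addmx_sub ?envelop_mx_id //.
  by rewrite eqmx_opp linearZ scalemx_sub ?envelop_mx1.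
have deltaE (i : 'I_n) : (delta_mx i i \in E_G)%MS.
  have [|d Ed [di d0]] := diagE i [seq j <- enum 'I_n | j != i].
    by rewrite mem_filter eqxx.
  suff -> : delta_mx i i = (d 0 i)^-1 *: diag_mx d.
    by rewrite linearZ scalemx_sub.
  apply/matrixP=> a b; rewrite !mxE; case: (eqVneq a b) => [<- | neq_ab].
    rewrite andbb mulr1n; case: eqVneq => [-> | neq_ai]; first by rewrite mulVf.
    suff -> : d 0 a = 0 by rewrite mulr0.
    by apply: d0; rewrite mem_filter neq_ai mem_enum.
  rewrite mulr0n mulr0; case: eqP => //= def_a; case: eqP => // def_b.
  by rewrite def_a def_b eqxx in neq_ab.
have unitE (i j : 'I_n) : (delta_mx i j \in E_G)%MS.
  have [g Gg [c nz_c def_g]] := trans i j.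
  suff -> : delta_mx i j = c^-1 *: (delta_mx i i *m rG g).
    by rewrite linearZ scalemx_sub // envelop_mxM ?envelop_mx_id.
  rewrite -[X in X *m rG g](mul_delta_mx (0 : 'I_1)) -mulmxA -rowE def_g.
  by rewrite -scalemxAr scalerA mulVf // scale1r mul_delta_mx.
rewrite -sub1mx; apply: submx_trans (submx1 1%:M) _.
apply/row_subP=> k; rewrite -[row k _]vec_mxK [vec_mx _]matrix_sum_delta.
rewrite linear_sum summx_sub // => i _; rewrite linear_sum summx_sub // => j _.
by rewrite linearZ scalemx_sub ?unitE.
Qed.

End MonomialCriterion.

(** * Homomorphisms out of an induced representation *)

Section InducedHom.

Variables (F : fieldType) (gT : finGroupType) (G H : {group gT}).
Hypothesis sHG : H \subset G.

Definition coset_rep (i : 'I_#|G : H|) : gT := repr (enum_val i).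

Lemma coset_rep_in i : coset_rep i \in G.
Proof.
have /rcosetsP[x Gx def_i] := enum_valP i.
rewrite /coset_rep def_i; case: repr_rcosetP => h Hh.
by rewrite groupM // (subsetP sHG).
Qed.

Lemma coset_rep_exists x : x \in G -> exists k, (x * (coset_rep k)^-1)%g \in H.
Proof.
move=> Gx; have Hx: (H :* x)%g \in rcosets H G by apply/rcosetsP; exists x.
exists (enum_rank_in Hx (H :* x)%g); rewrite -mem_rcoset /coset_rep.
by rewrite enum_rankK_in // rcoset_repr rcoset_refl.
Qed.

Lemma coset_rep_inj i j : (coset_rep i * (coset_rep j)^-1)%g \in H -> i = j.
Proof.
have def_c k : enum_val k = (H :* coset_rep k)%g.
  have /rcosetsP[x Gx def_k] := enum_valP k.
  by rewrite /coset_rep def_k rcoset_repr.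
rewrite -mem_rcoset => /rcoset_eqP eq_ij.
by apply: enum_val_inj; rewrite !def_c.
Qed.

Variables (m n : nat) (rH : mx_representation F H m).
Variables (rG : mx_representation F G n) (W : 'M[F]_(m, n)).

Definition ind_hom : 'M[F]_(\sum_(i < #|G : H|) m, n) :=
  \mxcol_i (W *m rG (coset_rep i)).

(** Frobenius reciprocity: an [H]-homomorphism [W] from the inducing module to
    a [G]-module extends to the induced module by sending [w (x) t] to
    [(w W) t]. *)
Lemma ind_homP :
    (forall h, h \in H -> rH h *m W = W *m rG h) ->
  forall g, g \in G -> ind_repr sHG rH g *m ind_hom = ind_hom *m rG g.
Proof.
move=> homW g Gg; rewrite mul_mxblock_mxrow mxcol_mul; apply/eq_mxcolP => i.
have Gi := coset_rep_in i.
have [k Hk] := coset_rep_exists (groupM Gi Gg).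
rewrite (bigD1 k) //= big1 ?addr0 => [|k' neq_k'k]; last first.
  case: ifP => [Hk' | _]; last by rewrite mul0mx.
  case/eqP: neq_k'k; apply: coset_rep_inj.
  suff -> : (coset_rep k' * (coset_rep k)^-1 =
             (coset_rep i * g * (coset_rep k')^-1)^-1 *
             (coset_rep i * g * (coset_rep k)^-1))%g by rewrite groupM ?groupV.
  by rewrite !invMg invgK !mulgA mulgKV mulgKV.
rewrite Hk mulmxA homW // -!mulmxA -!repr_mxM ?coset_rep_in //.
  by rewrite mulgKV.
exact: (subsetP sHG).
Qed.

End InducedHom.

(** * Elements of the parabolic subgroup *)

Section Parabolic.

Variables (Fq : finFieldType) (V : vectType Fq) (form : {skew_symmetric V}).
Variables (n : nat) (u v : 'I_n -> V).
Hypotheses (hform : is_psymplectic form) (hbasis : symplectic_basis form u v).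

Local Notation fV := (finvect_type V).
Local Notation "''[' x , y ]" := (form x y) : ring_scope.
Local Notation M := (Mspace u).
Local Notation N := (Nspace v).
Local Notation SpM := (SpM_glob form u).

Lemma pairing_neq0 (x : V) : x \in N -> x != 0 -> exists2 m, m \in M & '[x, m] != 0.
Proof.
move=> Nx nz_x; have [[y /andP[My xy]] | noy] :=
  altP (@existsP fV (fun y => (y \in M) && ('[x, y] != 0))); first by exists y.
case/eqP: nz_x; apply: (memNM0 hbasis) => //.
apply: (M_orth hform hbasis) => y My; apply/eqP; apply: contraNT noy => xy.
by apply/existsP; exists y; rewrite My.
Qed.

(** A vector space is not the union of two proper subspaces. *)
Lemma common_pairing_neq0 (x y : V) : x \in N -> y \in N -> x != 0 -> y != 0 ->
  exists m, [/\ m \in M, '[x, m] != 0 & '[y, m] != 0].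
Proof.
move=> Nx Ny /(pairing_neq0 Nx)[a Ma xa] /(pairing_neq0 Ny)[b Mb yb].
have [ya | ya] := eqVneq '[y, a] 0; last by exists a.
have [xb | xb] := eqVneq '[x, b] 0; last by exists b.
exists (a + b); split; first exact: memvD.
  by rewrite Defs.formDr xb addr0.
by rewrite Defs.formDr ya add0r.
Qed.

(** Isometries of a non-degenerate form are injective, hence bijective since [V]
    is finite. *)
Lemma Sp_of_isometry (f : V -> V) :
    (forall a x y, f (a *: x + y) = a *: f x + f y) ->
    (forall x y, '[f x, f y] = '[x, y]) ->
  exists2 g : {perm fV}, g \in Sp form & forall x, g x = f x.
Proof.
move=> fL fI; have f_inj : injective (f : fV -> fV).
  move=> x y eq_f; apply/eqP; rewrite -subr_eq0; apply/eqP.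
  suff : (x - y : V) = 0 by [].
  have /eqP nondeg : nondegenerate form by case: hform.
  apply/eqP; rewrite -memv0 -nondeg; apply/mem_orthovP => z _.
  by rewrite Defs.formDl Defs.formNl -!(fI _ z) eq_f subrr.
exists (perm f_inj); last by move=> x; rewrite permE.
by apply/SpP; split=> [a x y | x y]; rewrite !permE.
Qed.

Lemma transvection_ex (m : V) (c : Fq) : m \in M ->
  exists2 t : {perm fV}, t \in SpM & forall x, t x = x + (c * '[x, m]) *: m.
Proof.
move=> Mm; pose f (x : V) := x + (c * '[x, m]) *: m.
have [|x y|t St def_t] := @Sp_of_isometry f; rewrite /f.
- move=> a x y; rewrite Defs.formDl Defs.formZl scalerDr scalerA addrACA -scalerDl.
  by rewrite mulrDr [c * (a * _)]mulrCA.
- rewrite !Defs.formDl !Defs.formDr !Defs.formZl !Defs.formZr (form_alt hform).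
  by rewrite [form m y]form_skew; ring.
exists t => //; apply/SpM_globP; split=> // x; rewrite def_t.
have Mcm : (c * '[x, m]) *: m \in M by apply: memvZ.
exact: rpredDr.
Qed.

(** For [m] in [M] and [w] in [N] the map [x |-> x + <x,m> w + d <x,w> m] is an
    isometry when [d (1 + <w,m>) = 1], and it acts on [V / M] as
    [x |-> x + <x,m> w]. With [w = z - y] and [<y,m> = 1] it sends [y] to [z]
    modulo [M], and [1 + <w,m> = <z,m>] has to be invertible: the vector [m]
    must pair non-trivially with both [y] and [z]. *)
Lemma SpM_transitive (y z : V) : y \in N -> z \in N -> y != 0 -> z != 0 ->
  exists2 g : {perm fV}, g \in SpM & projN u v (g y) = z.
Proof.
move=> Ny Nz nz_y nz_z.
have [m0 [Mm0 ym0 zm0]] := common_pairing_neq0 Ny Nz nz_y nz_z.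
have [m [Mm ym zm]] : exists m, [/\ m \in M, '[y, m] = 1 & '[z, m] != 0].
  exists ('[y, m0]^-1 *: m0); split; first exact: memvZ.
    by rewrite Defs.formZr mulVf.
  by rewrite Defs.formZr mulf_neq0 ?invr_eq0.
have [w [Nw def_z wm]] : exists w, [/\ w \in N, y + w = z & '[w, m] = '[z, m] - 1].
  exists (z - y); split; first exact: memvB; first by rewrite addrC subrK.
  by rewrite Defs.formDl Defs.formNl ym.
pose d := '[z, m]^-1.
pose f (x : V) := x + '[x, m] *: w + (d * '[x, w]) *: m.
have [|x x'|g Sg def_g] := @Sp_of_isometry f.
- move=> a x x'; rewrite /f !Defs.formDl !Defs.formZl mulrDr !scalerDl !scalerDr.
  rewrite !scalerA [d * (a * _)]mulrCA [RHS]addrACA; congr (_ + _).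
  exact: addrACA.
- rewrite /f !Defs.formDl !Defs.formDr !Defs.formZl !Defs.formZr.
  rewrite !(form_alt hform) [form m x']form_skew [form w x']form_skew.
  by rewrite [form m w]form_skew wm /d; field.
exists g; last first.
  apply: (projN_uniq hbasis) => //; rewrite def_g /f ym scale1r.
  by rewrite def_z addrAC subrr add0r; apply: memvZ.
have Mdm x : (d * '[x, w]) *: m \in M by apply: memvZ.
apply/SpM_globP; split=> // x; rewrite def_g; apply: etrans (rpredDr _ (Mdm x)) _.
apply/idP/idP=> [Mxw | Mx]; last by rewrite (M_isotropic hbasis Mx Mm) scale0r addr0.
have /eqP := M_isotropic hbasis Mxw Mm.
rewrite Defs.formDl Defs.formZl wm mulrBr mulr1 addrC subrK mulf_eq0 (negPf zm) orbF.
by move/eqP=> xm; rewrite xm scale0r addr0 in Mxw.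
Qed.

End Parabolic.

(** * The vectors [E_w^+-] *)

Section WeilVectors.

Variables (p : nat) (Fq : finFieldType).
Hypothesis charFq : p \in [pchar Fq].
Variables (V : vectType Fq) (form : {skew_symmetric V}).
Variables (n : nat) (u v : 'I_n -> V).
Hypotheses (hform : is_psymplectic form) (hbasis : symplectic_basis form u v).
Variables (F : fieldType) (lam : Fq -> F).
Hypothesis hlam : additive_character lam.

Local Notation fV := (finvect_type V).
Local Notation "''[' x , y ]" := (form x y) : ring_scope.
Local Notation M := (Mspace u).
Local Notation N := (Nspace v).
Local Notation SpM := (SpM_glob form u).
Local Notation E := (Epm v F p).

Lemma eq_opp_pchar (w : fV) : (w == - w) = (w == 0) || ~~ odd p.
Proof.
rewrite -addr_eq0 -mulr2n -scaler_nat scaler_eq0 orbC; congr (_ || _).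
rewrite -(dvdn_pcharf charFq); have p_pr := pcharf_prime charFq.
have [-> //|odd_p] := even_prime p_pr; rewrite odd_p.
have := odd_prime_gt2 odd_p p_pr; rewrite ltnNge => /negPf.
by case: (boolP (p %| 2)%N) => // /dvdn_leq->.
Qed.

Lemma additive_character_neq0 a : lam a != 0.
Proof.
case: hlam => lam0 lamD; apply: contra_eq_neq (lamD a (- a)) => lam_a.
by rewrite subrr lam0 lam_a mul0r oner_neq0.
Qed.

Lemma character_separates (a b : Fq) : (exists c, lam c != 1) -> a != b ->
  exists c, lam (c * a) != lam (c * b).
Proof.
case: hlam => lam0 lamD [c lam_c] neq_ab; exists (c / (a - b)).
apply: contraNneq lam_c => eq_lam; apply/eqP.
apply: (mulIf (additive_character_neq0 (c / (a - b) * b))).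
rewrite -lamD mul1r -eq_lam; congr lam.
rewrite -{1}[c](divfK (_ : a - b != 0)) ?subr_eq0 //.
by rewrite -mulrDr subrK.
Qed.

(** Transvections along [m] in [M] act on [E_w] by [lam (- c <w,m>^2)]; a
    vector [m] pairing nontrivially with both [w - w'] and [w + w'] separates
    the squares. *)
Lemma SpM_pt_separates (w w' : V) : (exists c, lam c != 1) ->
    w \in N -> w' \in N -> w != w' -> w != - w' ->
  exists t : {perm fV}, [/\ t \in SpM, forall x : V, t x - x \in M
                          & lam '[t w, w] != lam '[t w', w']].
Proof.
move=> lam_nontriv Nw Nw'; rewrite -subr_eq0 -[w == - w']addr_eq0 => nz_sub nz_add.
have [m [Mm sm am]] := common_pairing_neq0 hform hbasis
  (memvB Nw Nw') (memvD Nw Nw') nz_sub nz_add.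
have neq_sqr : - '[w, m] ^+ 2 != - '[w', m] ^+ 2.
  rewrite eqr_opp -subr_eq0 subr_sqr mulf_neq0 //.
    by rewrite -Defs.formNl -Defs.formDl.
  by rewrite -Defs.formDl.
have [c sep_c] := character_separates lam_nontriv neq_sqr.
have [t Gt def_t] := transvection_ex hform c Mm.
have tE (x : V) : '[t x, x] = c * - '[x, m] ^+ 2.
  rewrite def_t Defs.formDl Defs.formZl (form_alt hform) [form m x]form_skew.
  by ring.
exists t; split=> // [x|]; last by rewrite !tE.
have -> : t x - x = (c * '[x, m]) *: m :> V by rewrite def_t addrAC subrr add0r.
exact: memvZ.
Qed.

(** The sign [(-1) ^+ (eps && b)] is the one by which [chi_pm] depends on [b]. In
    characteristic two [w = - w], which excludes [b = true]. *)
Lemma Epm_opp eps (b : bool) (w : fV) : (w == - w -> ~~ b) ->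
  E eps ((-1) ^+ b *: w) = (-1) ^+ (eps && b) *: E eps w.
Proof.
case: b => wb; last by rewrite andbF !scale1r.
rewrite eq_opp_pchar in wb; rewrite andbT scaleN1r /Epm.
case: ifP wb => [_ _ | _]; last by rewrite orbT => /(_ isT).
by rewrite opprK scalerDr scalerA -expr2 sqrr_sign scale1r addrC.
Qed.

Lemma Epm_coord_eq eps (w : fV) i : w != 0 -> enum_val i = w -> E eps w 0 i = 1.
Proof.
move=> nz_w def_w; rewrite /Epm.
case: ifP => odd_p; rewrite !mxE def_w eqxx // eq_opp_pchar odd_p (negPf nz_w).
by rewrite mulr0 addr0.
Qed.

Lemma Epm_coord_neq eps (w : fV) i :
  enum_val i != w -> enum_val i != - w -> E eps w 0 i = 0.
Proof.
move=> /negPf neq_w /negPf neq_Nw; rewrite /Epm.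
by case: ifP => _; rewrite !mxE neq_w ?neq_Nw ?mulr0 ?addr0.
Qed.

Lemma Epm_neq0 eps (w : fV) : w \in N -> w != 0 -> E eps w != 0.
Proof.
move=> Nw nz_w; have vNw : w \in vset N by rewrite inE.
apply: contraTneq (oner_neq0 F) => /rowP/(_ (enum_rank_in vNw w)).
by rewrite (Epm_coord_eq _ nz_w) ?enum_rankK_in // mxE => ->; rewrite eqxx.
Qed.

Lemma hSstab_Epm eps (w : fV) (g : {perm fV}) : w \in N -> g \in hSstab form u w ->
  E eps w *m X_repr hform hbasis hlam g = chi_pm form u lam eps w g *: E eps w.
Proof.
move=> Nw Hg; have Gg := subsetP (hSstab_sub _ _ _) _ Hg.
have [b wb gw] := hSstab_sign Hg.
rewrite (chi_pm_val lam hbasis eps Gg Nw wb gw) /= (Epm_mul lam p eps Gg Nw).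
have -> : projN u v (g w) = (-1) ^+ b *: w :> fV.
  by apply: (projN_uniq hbasis) => //; apply: memvZ.
by rewrite Epm_opp // scalerA mulrC Defs.formZr.
Qed.

(** The component in [N] determines a vector modulo [M], and [h^-1] preserves
    [M], so it can be applied to the congruence between [g w] and [+- h w]. *)
Lemma mem_hSstab_div (w : V) (g h : {perm fV}) : g \in SpM -> h \in SpM ->
    projN u v (g w) = projN u v (h w) \/ projN u v (g w) = - projN u v (h w) ->
  (g * h^-1)%g \in hSstab form u w.
Proof.
move=> Gg Gh eq_gh; rewrite hSstabE groupM ?groupV // permM.
have Gh' : h^-1%g \in SpM by rewrite groupV.
have addh : {morph h^-1%g : x y / x + y} := Sp_add (SpM_Sp Gh').
have opph : {morph h^-1%g : x / - x} := Sp_opp (SpM_Sp Gh').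
have hK : h^-1%g (h w) = w by rewrite permK.
have gM := projN_sub hbasis (g w); have hM := projN_sub hbasis (h w).
case: eq_gh => eq_gh; apply/orP; rewrite eq_gh in gM.
  left; rewrite -[X in _ - X]hK -opph -addh (SpM_mem Gh').
  by have := memvB gM hM; rewrite opprB addrA subrK.
right; rewrite -[X in _ + X]hK -addh (SpM_mem Gh').
by have := memvD gM hM; rewrite opprK addrACA subrr addr0.
Qed.

End WeilVectors.

(** * The module [X^+-] as an induced module *)

Section InducedModule.

Variables (p : nat) (Fq : finFieldType).
Hypothesis charFq : p \in [pchar Fq].
Variables (V : vectType Fq) (form : {skew_symmetric V}).
Variables (n : nat) (u v : 'I_n -> V).
Hypotheses (hform : is_psymplectic form) (hbasis : symplectic_basis form u v).
Variables (F : fieldType) (lam : Fq -> F).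
Hypothesis hlam : additive_character lam.
Variables (eps : bool) (w : finvect_type V).
Hypotheses (Nw : w \in Nspace v) (nz_w : w != 0).

Local Notation fV := (finvect_type V).
Local Notation N := (Nspace v).
Local Notation SpM := (SpM_glob form u).
Local Notation H := (hSstab_group form u w).
Local Notation X := (X_repr hform hbasis hlam).
Local Notation E := (Epm v F p eps).
Local Notation indX :=
  (ind_repr (hSstab_sub form u w) (chi_repr hform hbasis hlam eps Nw)).
Local Notation coset_ix := (@tagnat.sig1 _ (fun _ : 'I_#|SpM : H| => 1%N)).
Local Notation rep := (@coset_rep _ SpM H).

Definition Epm_translates : 'M[F]_(\sum_(i < #|SpM : H|) 1, #|vset N|) :=
  ind_hom H X (E w).
Local Notation B := Epm_translates.

Lemma Epm_translates_hom g : g \in SpM -> indX g *m B = B *m X g.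
Proof.
apply: ind_homP => h Hh.
by rewrite (hSstab_Epm charFq) // mul_scalar_mx.
Qed.

Lemma row_Epm_translates s : row s B = E w *m X (rep (coset_ix s)).
Proof. by rewrite row_mxcol row_id. Qed.

(** [row s B] spans the line of [E (rep_vec s)]. *)
Definition rep_vec s : fV := projN u v (rep (coset_ix s) w).

Lemma rep_vec_in s : rep_vec s \in N.
Proof. exact: (projN_in u v (rep (coset_ix s) w)). Qed.

Lemma rep_vec_neq0 s : rep_vec s != 0.
Proof. by apply: (SpM_projN hbasis); rewrite ?coset_rep_in ?hSstab_sub. Qed.

Lemma row_Epm_translatesE s : exists2 c, c != 0 & row s B = c *: E (rep_vec s).
Proof.
rewrite row_Epm_translates /= Epm_mul ?coset_rep_in ?hSstab_sub //.
by exists (lam (form (rep (coset_ix s) w) (rep_vec s)));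
  first exact: additive_character_neq0.
Qed.

Lemma rep_vec_neq s t : s != t ->
  rep_vec s != rep_vec t /\ rep_vec s != - rep_vec t.
Proof.
move=> neq_st; suff noteq : ~ (rep_vec s = rep_vec t \/ rep_vec s = - rep_vec t).
  by split; apply/eqP=> eq_yz; case: noteq; [left | right].
move=> eq_yz; case/eqP: neq_st.
have eq_sig : coset_ix s = coset_ix t.
  apply: coset_rep_inj; apply: (mem_hSstab_div hbasis) => //;
  exact/coset_rep_in/hSstab_sub.
rewrite -[s]tagnat.sig2K -[t]tagnat.sig2K.
move: (@tagnat.sig2 _ _ s) (@tagnat.sig2 _ _ t); rewrite eq_sig => i j.
by rewrite (ord1 i) (ord1 j).
Qed.

(** At the coordinate [rep_vec s] only the [s]-th translate is non-zero, because
    [E y] is supported on [y] and [- y]. *)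
Lemma Epm_translates_free : row_free B.
Proof.
apply: inj_row_free => a aB0; apply/rowP=> s; rewrite mxE.
have [c nz_c def_s] := row_Epm_translatesE s.
have vNy : rep_vec s \in vset N by rewrite in_set rep_vec_in.
pose k := enum_rank_in vNy (rep_vec s).
have def_k : enum_val k = rep_vec s by rewrite enum_rankK_in.
move/rowP/(_ k): aB0; rewrite (mulmx_sum_row a B) summxE (bigD1 s) //=.
rewrite [X in _ + X]big1 => [|t neq_ts].
  rewrite def_s !mxE (Epm_coord_eq charFq F eps (rep_vec_neq0 s) def_k) mulr1 addr0.
  by move/eqP; rewrite mulf_eq0 (negPf nz_c) orbF => /eqP.
have [d _ ->] := row_Epm_translatesE t; have [neq1 neq2] := rep_vec_neq neq_ts.
rewrite !mxE Epm_coord_neq ?mulr0 // def_k; first by rewrite eq_sym.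
by rewrite eq_sym eqr_oppLR.
Qed.

(** If [g] moves [w] to [y] modulo [M], then [g = h t] with [h] in [H] and [t] a
    representative, so the line of [E y] is that of the translate by [t]. *)
Lemma Epm_translates_eq : (B :=: Xpm v F p eps)%MS.
Proof.
apply/eqmxP/andP; split.
  apply/row_subP=> s; have [c _ ->] := row_Epm_translatesE s.
  apply: scalemx_sub; apply: (sumsmx_sup (rep_vec s)); last by rewrite genmxE.
  by rewrite in_setD1 rep_vec_neq0 in_set rep_vec_in.
apply/sumsmx_subP=> y; rewrite !inE genmxE => /andP[nz_y Ny].
have [g Gg def_y] := SpM_transitive hform hbasis Nw Ny nz_w nz_y.
have EgB : (E w *m X g <= B)%MS.
  have [k Hk] := coset_rep_exists H Gg.
  have Gk := coset_rep_in (hSstab_sub form u w) k.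
  have -> : g = (g * (rep k)^-1 * rep k)%g by rewrite mulgKV.
  rewrite repr_mxM // ?groupM ?groupV // mulmxA (hSstab_Epm charFq) //.
  rewrite -scalemxAl scalemx_sub //.
  have -> : E w *m X (rep k) = row (tagnat.Rank k 0) B.
    by rewrite row_Epm_translates tagnat.Rank1K.
  exact: row_sub.
move: EgB; rewrite /= Epm_mul // def_y eqmx_scale //.
exact: additive_character_neq0.
Qed.

Lemma Xpm_rsim_ind : mx_rsim (Xpm_repr hform hbasis hlam p eps) indX.
Proof.
apply: mx_rsim_sym; have sBX : (B <= Xpm v F p eps)%MS by rewrite Epm_translates_eq.
apply: (MxReprSim (B := in_submod (Xpm v F p eps) B)).
- by have := Epm_translates_free; rewrite /row_free Epm_translates_eq => /eqP/esym.
- by rewrite /row_free mxrank_in_submod //; apply: Epm_translates_free.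
move=> g Gg; rewrite -in_submodJ // -Epm_translates_hom //.
by rewrite in_submodE [in RHS]in_submodE mulmxA.
Qed.

(** Matrix identities for [indX] are checked after multiplication by [B], where
    they become computations with the vectors [E y]. *)
Lemma ind_abs_irr : (exists a, lam a != 1) -> mx_absolutely_irreducible indX.
Proof.
move=> lam_nontriv; have freeB := row_free_inj Epm_translates_free.
have sub_rep := coset_rep_in (hSstab_sub form u w).
apply: separated_monomial_abs_irr => [|s t neq_st|s t].
- by rewrite sum_nat_const card_ord muln1.
- have [neq1 neq2] := rep_vec_neq neq_st.
  have [g [Gg gM sep]] := SpM_pt_separates hform hbasis hlam lam_nontriv
    (rep_vec_in _) (rep_vec_in _) neq1 neq2.
  exists g, (\row_i lam (form (g (rep_vec i)) (rep_vec i))).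
  split; rewrite // ?mxE //; apply: freeB; rewrite Epm_translates_hom //.
  apply/row_matrixP=> i; rewrite !row_mul row_diag_mx -scalemxAl -rowE mxE.
  have [c _ ->] := row_Epm_translatesE i; have Ny := rep_vec_in i.
  rewrite -scalemxAl /= Epm_mul // (projN_uniq hbasis Ny (gM _)).
  by rewrite !scalerA mulrC.
exists ((rep (coset_ix s))^-1 * rep (coset_ix t))%g.
  by rewrite groupM ?groupV.
exists 1; rewrite ?oner_neq0 // scale1r; apply: freeB.
rewrite -row_mul -rowE Epm_translates_hom ?groupM ?groupV // row_mul.
by rewrite !row_Epm_translates -mulmxA -repr_mxM ?groupM ?groupV // mulKVg.
Qed.

End InducedModule.

(** * Absolute irreducibility and induction from [hSstab] *)

Theorem theorem3p11
  (p : nat) (Fq : finFieldType) (charFq : p \in [pchar Fq])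
  (n : nat) (V : vectType Fq) (dimV : \dim {:V} = (2 * n.+1)%N)
  (form : {skew_symmetric V}) (hform : is_psymplectic form)
  (u v : 'I_n.+1 -> V) (hbasis : symplectic_basis form u v)
  (F : fieldType) (charF : p \notin [pchar F])
  (hroot : exists z : F, p.-primitive_root z)
  (lam : Fq -> F) (hlam : additive_character lam)
  (lam_nontriv : exists a : Fq, lam a != 1)
  (eps : bool) :
  let rX := Xpm_repr hform hbasis hlam p eps in
  let vn := v ord_max in
  let Evn := Epm v F p eps vn in
  let rchi := chi_repr hform hbasis hlam eps (v_in_N v ord_max) in
  [/\ mx_absolutely_irreducible rX,
      forall (K : fieldType) (f : {rmorphism F -> K}),
        mx_irreducible (map_repr f rX),
      Evn != 0 /\
      (forall g, g \in hSstab form u vn ->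
         Evn *m X_repr hform hbasis hlam g
           = chi_pm form u lam eps vn g *: Evn)
    & mx_rsim rX (ind_repr (hSstab_sub form u vn) rchi)].
Proof.
have Nvn := v_in_N v ord_max.
have nz_vn : v ord_max != 0.
  case: hbasis => _ uv _ _; apply/eqP=> vn0; have := uv ord_max ord_max.
  by rewrite vn0 linear0r eqxx => /eqP; rewrite eq_sym oner_eq0.
move=> rX vn Evn rchi.
have rsimX : mx_rsim rX (ind_repr (hSstab_sub form u vn) rchi).
  exact: Xpm_rsim_ind.
have irrX : mx_absolutely_irreducible rX.
  by rewrite (mx_rsim_abs_irr rsimX); apply: (ind_abs_irr charFq).
split=> // [K f|].
  by apply: mx_abs_irrW; rewrite map_mx_abs_irr.
split; first exact: Epm_neq0.
by move=> g Hg; apply: hSstab_Epm.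
Qed.
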